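(* Let $q\in\mathbb{C}\setminus\{0\}$ be not a root of unity, and let $\varphi$ be a $\frac12$-derivation of the $q$-quantum torus Lie algebra $\tilde{L(q)}$. Then there exist $c,d\in\mathbb{C}$ such that for all $\mathbf m\in\mathbb{Z}^2\setminus\{\mathbf 0\}$ $$\varphi(x^{\mathbf m})=(c+d)x^{\mathbf m},\qquad \varphi(D(\mathbf m))=c\,x^{\mathbf m}+d\,D(\mathbf m).$$
   Context: ''Not a root of unity'' means $q^t\neq 1$ for all positive integers $t$. For such $q$, the $q$-quantum torus Lie algebra $\tilde{L(q)}$ is the complex Lie algebra with basis $\{x^{\mathbf m},D(\mathbf m)\mid\mathbf m\in\mathbb{Z}^2\setminus\{\mathbf 0\}\}$ and anticommutative bracket given, for $\mathbf m,\mathbf n\in\mathbb{Z}^2\setminus\{\mathbf 0\}$, by $[x^{\mathbf m},x^{\mathbf n}]=\lambda(\mathbf m,\mathbf n)x^{\mathbf m+\mathbf n}$, $[D(\mathbf m),x^{\mathbf n}]=\lambda(\mathbf m,\mathbf n)x^{\mathbf m+\mathbf n}$, $[D(\mathbf m),D(\mathbf n)]=\lambda(\mathbf m,\mathbf n)D(\mathbf m+\mathbf n)$, where $\lambda(\mathbf m,\mathbf n)=q^{m_2n_1}-q^{m_1n_2}$ for $\mathbf m=(m_1,m_2)$, $\mathbf n=(n_1,n_2)$, with the conventions that the symbols $x^{\mathbf 0}$ and $D(\mathbf 0)$ denote $0$. A linear map $\varphi:L\to L$ on a Lie algebra $L$ is a $\frac12$-derivation if $\varphi([x,y])=\frac12\left([\varphi(x),y]+[x,\varphi(y)]\right)$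 for all $x,y\in L$. *)

(* Defs.v *)
From HB Require Import structures.
From mathcomp Require Import all_boot all_order all_algebra finmap.
From mathcomp Require Import xfinmap monalg complex reals ring.

Set Implicit Arguments.
Unset Strict Implicit.
Unset Printing Implicit Defensive.

Import GRing.Theory.

Local Open Scope ring_scope.

Section LieAlgebras.
Context {K : fieldType} {L : lmodType K}.

Definition is_lie_bracket (br : L -> L -> L) : Prop :=
  [/\ forall z, linear (fun x => br x z),
      forall x, linear (br x),
      forall x, br x x = 0 &
      forall x y z, br x (br y z) + br y (br z x) + br z (br x y) = 0].

Definition half_derivation (br : L -> L -> L) (phi : {linear L -> L}) : Prop :=
  forall x y, phi (br x y) = 2^-1 *: (br (phi x) y + br x (phi y)).

End LieAlgebras.

Section LinearExtension.
Context {K : fieldType} {I : choiceType} {L : lmodType K}.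

Definition malg_lift (F : I -> L) (g : {malg K[I]}) : L :=
  \sum_(i <- msupp g) g@_i *: F i.

Lemma malg_liftEw (F : I -> L) (g : {malg K[I]}) (d : {fset I}) :
  (msupp g `<=` d)%fset -> malg_lift F g = \sum_(i <- d) g@_i *: F i.
Proof.
move=> le_gd; rewrite /malg_lift (big_fset_incl _ le_gd) //.
by move=> i _ /mcoeff_outdom ->; rewrite scale0r.
Qed.

Fact malg_lift_linear (F : I -> L) : linear (malg_lift F).
Proof.
move=> a f g.
pose d := (msupp (a *: f + g) `|` (msupp f `|` msupp g))%fset.
rewrite (@malg_liftEw F _ d) ?fsubsetUl //.
rewrite (@malg_liftEw F f d); last first.
  by apply: fsubset_trans (fsubsetUr _ _); exact: fsubsetUl.
rewrite (@malg_liftEw F g d); last first.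
  by apply: fsubset_trans (fsubsetUr _ _); exact: fsubsetUr.
rewrite scaler_sumr -big_split /=; apply: eq_bigr => i _.
by rewrite mcoeffD mcoeffZ scalerDl scalerA.
Qed.

HB.instance Definition _ (F : I -> L) :=
  GRing.isLinear.Build K {malg K[I]} L *:%R (malg_lift F) (malg_lift_linear F).

Lemma malg_liftU (F : I -> L) (i : I) : malg_lift F << i >> = F i.
Proof.
rewrite (@malg_liftEw F _ [fset i]%fset) ?msuppU_le //.
by rewrite big_seq_fset1 mcoeffUU scale1r.
Qed.

Lemma malg_linear_eq0 (F : {malg K[I]} -> L) :
  linear F -> (forall i, F << i >> = 0) -> forall g, F g = 0.
Proof.
move=> linF F0 g.
pose F' : {linear {malg K[I]} -> L} :=
  HB.pack F (GRing.isLinear.Build K {malg K[I]} L *:%R F linF).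
rewrite -[F]/(F' : _ -> _) (monalgE g) raddf_sum big1 //= => i _.
have -> : << g@_i *g i >> = g@_i *: << i >> :> {malg K[I]}.
  by apply/malgP => k; rewrite mcoeffZ !mcoeffU mulr_natr.
by rewrite -[F]/(F' : _ -> _) linearZ /= F0 scaler0.
Qed.

End LinearExtension.

Definition Z2 : zmodType := (int * int)%type.
Definition Z2star : choiceType := {m : Z2 | m != 0}.

(* [inl m] indexes the basis vector x^m and [inr m] the basis vector D(m). *)
Definition qtorus (K : fieldType) : lmodType K :=
  {malg K[(Z2star + Z2star)%type]}.

(* Locked because unifying an [xgen] with a [Dgen] otherwise unfolds the
   finitely supported functions and does not terminate in practice. *)
HB.lock Definition xgen (K : fieldType) (m : Z2) : qtorus K :=
  if insub m is Some m' then << inl (m' : Z2star) >> else 0.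

HB.lock Definition Dgen (K : fieldType) (m : Z2) : qtorus K :=
  if insub m is Some m' then << inr (m' : Z2star) >> else 0.

Arguments xgen {K} m.
Arguments Dgen {K} m.

Section QuantumTorus.
Context {K : fieldType}.

Local Notation qtorus := (qtorus K).

Definition qlambda (q : K) (m n : Z2) : K := q ^ (m.2 * n.1) - q ^ (m.1 * n.2).

(* The second line is forced by [x^m, D(n)] = - [D(n), x^m]. *)
Definition qbracket_basis (q : K) (i j : Z2star + Z2star) : qtorus :=
  match i, j with
  | inl m, inl n => qlambda q (val m) (val n) *: xgen (val m + val n)
  | inl m, inr n => - (qlambda q (val n) (val m) *: xgen (val n + val m))
  | inr m, inl n => qlambda q (val m) (val n) *: xgen (val m + val n)
  | inr m, inr n => qlambda q (val m) (val n) *: Dgen (val m + val n)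
  end.

Definition qbracket (q : K) (u v : qtorus) : qtorus :=
  malg_lift (fun i => malg_lift (qbracket_basis q i) v) u.

Lemma xgen0 : xgen 0 = 0 :> qtorus.
Proof. by rewrite xgen.unlock insubF ?eqxx. Qed.

Lemma Dgen0 : Dgen 0 = 0 :> qtorus.
Proof. by rewrite Dgen.unlock insubF ?eqxx. Qed.

Lemma xgenE (m : Z2star) : xgen (val m) = << inl m >> :> qtorus.
Proof. by rewrite xgen.unlock valK. Qed.

Lemma DgenE (m : Z2star) : Dgen (val m) = << inr m >> :> qtorus.
Proof. by rewrite Dgen.unlock valK. Qed.

Lemma qbracketU (q : K) i j :
  qbracket q << i >> << j >> = qbracket_basis q i j.
Proof. by rewrite /qbracket !malg_liftU. Qed.

Lemma qbracket_linearl (q : K) (v : qtorus) :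
  linear (fun u : qtorus => qbracket q u v).
Proof. exact: malg_lift_linear. Qed.

Lemma qbracket_linearr (q : K) (u : qtorus) : linear (qbracket q u).
Proof.
move=> a v w; rewrite /qbracket /malg_lift scaler_sumr -big_split /=.
apply: eq_bigr => i _; rewrite -!/(malg_lift _ _) malg_lift_linear.
by rewrite scalerDr !scalerA mulrC.
Qed.

Lemma qlambdaC (q : K) m n : qlambda q n m = - qlambda q m n.
Proof. by rewrite /qlambda opprB [n.2 * _]mulrC [n.1 * _]mulrC. Qed.

Lemma qbracket0l (q : K) v : qbracket q 0 v = 0.
Proof. exact: (raddf0 (malg_lift _)). Qed.

Lemma qbracket0r (q : K) u : qbracket q u 0 = 0.
Proof.
have := qbracket_linearr q u (-1) 0 0.
by rewrite scaleN1r oppr0 addr0 scaleN1r addNr.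
Qed.

Lemma qbracketZr (q : K) a u v : qbracket q u (a *: v) = a *: qbracket q u v.
Proof. by have := qbracket_linearr q u a v 0; rewrite qbracket0r !addr0. Qed.

Lemma qbracketDr (q : K) u v w :
  qbracket q u (v + w) = qbracket q u v + qbracket q u w.
Proof. by have := qbracket_linearr q u 1 v w; rewrite !scale1r. Qed.

Lemma qbracketZl (q : K) a u v : qbracket q (a *: u) v = a *: qbracket q u v.
Proof. by have := qbracket_linearl q v a u 0; rewrite qbracket0l !addr0. Qed.

Lemma qbracketDl (q : K) u v w :
  qbracket q (u + v) w = qbracket q u w + qbracket q v w.
Proof. by have := qbracket_linearl q w 1 u v; rewrite !scale1r. Qed.

Lemma Z2P (m : Z2) : m = 0 \/ exists m' : Z2star, m = val m'.
Proof.
by have [->|m0] := eqVneq m 0; [left | right; exists (Sub m m0)].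
Qed.

Lemma qlambda0r (q : K) m : qlambda q m 0 = 0.
Proof. by rewrite /qlambda !mulr0 subrr. Qed.

Lemma qlambda0l (q : K) m : qlambda q 0 m = 0.
Proof. by rewrite /qlambda !mul0r subrr. Qed.

Lemma qbracket_xx (q : K) m n :
  qbracket q (xgen m) (xgen n) = qlambda q m n *: xgen (m + n).
Proof.
have [->|[{}m ->]] := Z2P m; first by rewrite xgen0 qbracket0l qlambda0l scale0r.
have [->|[{}n ->]] := Z2P n; first by rewrite xgen0 qbracket0r qlambda0r scale0r.
by rewrite !xgenE qbracketU.
Qed.

Lemma qbracket_Dx (q : K) m n :
  qbracket q (Dgen m) (xgen n) = qlambda q m n *: xgen (m + n).
Proof.
have [->|[{}m ->]] := Z2P m; first by rewrite Dgen0 qbracket0l qlambda0l scale0r.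
have [->|[{}n ->]] := Z2P n; first by rewrite xgen0 qbracket0r qlambda0r scale0r.
by rewrite xgenE DgenE qbracketU.
Qed.

Lemma qbracket_DD (q : K) m n :
  qbracket q (Dgen m) (Dgen n) = qlambda q m n *: Dgen (m + n).
Proof.
have [->|[{}m ->]] := Z2P m; first by rewrite Dgen0 qbracket0l qlambda0l scale0r.
have [->|[{}n ->]] := Z2P n; first by rewrite Dgen0 qbracket0r qlambda0r scale0r.
by rewrite !DgenE qbracketU.
Qed.

Lemma qbracket_xD (q : K) m n :
  qbracket q (xgen m) (Dgen n) = qlambda q m n *: xgen (m + n).
Proof.
have [->|[{}m ->]] := Z2P m; first by rewrite xgen0 qbracket0l qlambda0l scale0r.
have [->|[{}n ->]] := Z2P n; first by rewrite Dgen0 qbracket0r qlambda0r scale0r.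
by rewrite xgenE DgenE qbracketU /= qlambdaC scaleNr opprK addrC.
Qed.

Lemma qtorus_ind (F : qtorus -> qtorus) : linear F ->
  (forall m, F (xgen m) = 0) -> (forall m, F (Dgen m) = 0) ->
  forall u, F u = 0.
Proof.
move=> linF Fx FD; apply: malg_linear_eq0 linF _ => -[m|m].
  by rewrite -xgenE; exact: Fx.
by rewrite -DgenE; exact: FD.
Qed.

Lemma qbracketC (q : K) u v : qbracket q u v = - qbracket q v u.
Proof.
apply/eqP; rewrite -addr_eq0; apply/eqP; move: u.
apply: qtorus_ind => [a u w|m|m].
- by rewrite qbracketDl qbracketZl qbracketDr qbracketZr scalerDr addrACA.
- move: v; apply: qtorus_ind => [a u w|n|n].
  + by rewrite qbracketDl qbracketZl qbracketDr qbracketZr scalerDr addrACA.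
  + by rewrite !qbracket_xx qlambdaC (addrC m) -scalerDl addNr scale0r.
  + rewrite qbracket_xD qbracket_Dx.
    by rewrite qlambdaC (addrC m) -scalerDl addNr scale0r.
- move: v; apply: qtorus_ind => [a u w|n|n].
  + by rewrite qbracketDl qbracketZl qbracketDr qbracketZr scalerDr addrACA.
  + rewrite qbracket_xD qbracket_Dx.
    by rewrite qlambdaC (addrC m) -scalerDl addNr scale0r.
  + by rewrite !qbracket_DD qlambdaC (addrC m) -scalerDl addNr scale0r.
Qed.

Lemma qlambdamm (q : K) m : qlambda q m m = 0.
Proof. by rewrite /qlambda mulrC subrr. Qed.

Lemma qbracketxx (q : K) u : qbracket q u u = 0.
Proof.
have bU i : qbracket q << i >> << i >> = 0.
  by rewrite qbracketU; case: i => m /=; rewrite qlambdamm scale0r.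
have alt (s : seq (Z2star + Z2star)) (c : Z2star + Z2star -> K) :
  let w : qtorus := \sum_(i <- s) c i *: << i >> in qbracket q w w = 0.
  elim: s => [|i s IHs] /=; first by rewrite big_nil qbracket0l.
  rewrite big_cons; move: IHs => /=; set w : qtorus := \sum_(_ <- s) _ => IHs.
  rewrite qbracketDl !qbracketDr IHs addr0 qbracketZl qbracketZr bU !scaler0.
  by rewrite add0r [X in _ + X]qbracketC subrr.
have -> : u = \sum_(i <- msupp u) u@_i *: << i >> :> qtorus.
  rewrite {1}(monalgE u); apply: eq_bigr => i _.
  by apply/malgP => k; rewrite mcoeffZ !mcoeffU mulr_natr.
exact: (alt (msupp u) (fun i => u@_i)).
Qed.

Lemma qlambda_jacobi (q : K) m n p : q != 0 ->
  qlambda q n p * qlambda q m (n + p) + qlambda q p m * qlambda q n (p + m)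
  + qlambda q m n * qlambda q p (m + n) = 0.
Proof.
move=> q0; case: m n p => [m1 m2] [n1 n2] [p1 p2]; rewrite /qlambda /=.
rewrite !mulrDr !expfzDr // (mulrC n1 m2) (mulrC n2 m1) (mulrC p1 m2).
rewrite (mulrC p2 m1) (mulrC p1 n2) (mulrC p2 n1).
by ring.
Qed.

Lemma qbracket_jacobi (q : K) u v w : q != 0 ->
  qbracket q u (qbracket q v w) + qbracket q v (qbracket q w u)
  + qbracket q w (qbracket q u v) = 0.
Proof.
move=> q0; have lin (a : K) (x y x1 y1 x2 y2 : qtorus) :
    a *: x + y + (a *: x1 + y1) + (a *: x2 + y2)
    = a *: (x + x1 + x2) + (y + y1 + y2).
  by rewrite !scalerDr (addrACA (a *: x) y) (addrACA (a *: x + _)).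
have bE := (qbracket_xx, qbracket_xD, qbracket_Dx, qbracket_DD, qbracketZr).
have rot (m n p : Z2) : (n + (p + m) = m + (n + p)) * (p + (m + n) = m + (n + p)).
  by split; [rewrite addrA addrC | rewrite addrC addrA].
have fin m n p (z : qtorus) :
    qlambda q n p *: (qlambda q m (n + p) *: z)
    + qlambda q p m *: (qlambda q n (p + m) *: z)
    + qlambda q m n *: (qlambda q p (m + n) *: z) = 0.
  by rewrite !scalerA -!scalerDl qlambda_jacobi // scale0r.
move: u; apply: qtorus_ind => [a u u'|m|m].
- by rewrite !(qbracketDl, qbracketZl, qbracketDr, qbracketZr) lin.
- move: v; apply: qtorus_ind => [a v v'|n|n].
  + by rewrite !(qbracketDl, qbracketZl, qbracketDr, qbracketZr) lin.
  + move: w; apply: qtorus_ind => [a w w'|p|p].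
    * by rewrite !(qbracketDl, qbracketZl, qbracketDr, qbracketZr) lin.
    * by rewrite !bE !(rot m n p) fin.
    * by rewrite !bE !(rot m n p) fin.
  + move: w; apply: qtorus_ind => [a w w'|p|p].
    * by rewrite !(qbracketDl, qbracketZl, qbracketDr, qbracketZr) lin.
    * by rewrite !bE !(rot m n p) fin.
    * by rewrite !bE !(rot m n p) fin.
- move: v; apply: qtorus_ind => [a v v'|n|n].
  + by rewrite !(qbracketDl, qbracketZl, qbracketDr, qbracketZr) lin.
  + move: w; apply: qtorus_ind => [a w w'|p|p].
    * by rewrite !(qbracketDl, qbracketZl, qbracketDr, qbracketZr) lin.
    * by rewrite !bE !(rot m n p) fin.
    * by rewrite !bE !(rot m n p) fin.
  + move: w; apply: qtorus_ind => [a w w'|p|p].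
    * by rewrite !(qbracketDl, qbracketZl, qbracketDr, qbracketZr) lin.
    * by rewrite !bE !(rot m n p) fin.
    * by rewrite !bE !(rot m n p) fin.
Qed.

Lemma qbracket_is_lie (q : K) : q != 0 -> is_lie_bracket (qbracket q).
Proof.
move=> q0; split=> [v|u|u|u v w].
- exact: qbracket_linearl.
- exact: qbracket_linearr.
- exact: qbracketxx.
- exact: qbracket_jacobi.
Qed.

End QuantumTorus.

(* Main.v *)
From HB Require Import structures.
Require Import Defs.
From mathcomp Require Import all_boot all_order all_algebra.
From mathcomp Require Import complex reals.
From mathcomp Require Import monalg ring zify.

Set Implicit Arguments.
Unset Strict Implicit.
Unset Printing Implicit Defensive.

Import GRing.Theory Num.Theory.

Local Open Scope ring_scope.

(** Fix a degree [d]. The coefficient [f m] of [x^(m+d)] in [phi (D m)], and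
    likewise the coefficient of [D(m+d)] there and that of [x^(m+d)] in
    [phi (x^m)], all satisfy the same scalar equation
      [2 l(m,n) f(m+n) = l(m+d,n) f(m) + l(m,n+d) f(n)],
    where [l] is the structure constant; this is [half_cocycle]. Because [q] is
    not a root of unity, [l(m,n)] vanishes only for collinear [m] and [n].

    If [d <> 0], the equation at [n = d] and at [n = -d] gives, for [m] not
    collinear with [d] and with [Q = q^(d1 d2)], [P(m) = q^(m2 d1) + q^(m1 d2)]:
      [f(m+d) = 2 Q f(m)]   and   [3 Q f(m) = P(m) f(d)].
    Since [P(m+d) = Q P(m)], the second formula forces [f(m+d) = Q f(m)],
    against the first unless [f(m) = 0]. Points of the line through [d] are
    reached as sums of two points off it, so [f] vanishes
    ([half_cocycle_eq0]). If [d = 0], the equation says that [f] takes the mean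
    value at sums of independent vectors, and such an [f] is constant
    ([half_cocycle_const]). Hence only the degree [0] coefficients survive, and
    they do not depend on [m].

    Two more brackets finish the proof. [phi (x^m)] has no [D]-component, since
    [x^m] is a multiple of a bracket of two [x]'s and every bracket with an [x]
    lies in the span of the [x]'s ([Dcoef_phi_x]). Finally
    [[D m, x^n] = l(m,n) x^(m+n)] identifies the scalar on the [x]'s with the
    sum of the two scalars of [phi (D m)] ([xcoef_phi_sum]). *)

(** * Independent vectors of the lattice *)

Definition indep (m n : Z2) : bool := m.2 * n.1 != m.1 * n.2.

(** The vectors (1,0), (0,1), (1,1) are pairwise independent, so each of the two
    given lines contains at most one of them. *)
Lemma exists_indep2 (m n : Z2) : m != 0 -> n != 0 ->
  exists k : Z2, indep k m /\ indep k n.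
Proof.
case: m n => [m1 m2] [n1 n2]; rewrite -!pair_eqE /indep /= => m0 n0.
have [m2z|m2nz] := eqVneq m2 0; have [n2z|n2nz] := eqVneq n2 0.
- by exists (0, 1) => /=; lia.
- have [n1z|n1nz] := eqVneq n1 0; last by exists (0, 1) => /=; lia.
  by exists (1, 1) => /=; lia.
- have [m1z|m1nz] := eqVneq m1 0; last by exists (0, 1) => /=; lia.
  by exists (1, 1) => /=; lia.
- by exists (1, 0) => /=; lia.
Qed.

Lemma indepDl (m n : Z2) : indep (m + n) n = indep m n.
Proof. by rewrite /indep /=; apply/idP/idP => h; apply/negP => /eqP; nia. Qed.

Lemma indepNr (m n : Z2) : indep m (- n) = indep m n.
Proof. by rewrite /indep /=; apply/idP/idP => h; apply/negP => /eqP; nia. Qed.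

Lemma indepBr (m n : Z2) : indep m (n - m) = indep m n.
Proof. by rewrite /indep /=; apply/idP/idP => h; apply/negP => /eqP; nia. Qed.

Lemma indepBl_dep (m n p : Z2) : indep m p -> ~~ indep n p -> indep (n - m) p.
Proof. by rewrite /indep negbK /= => h1 h2; apply/negP => /eqP; nia. Qed.

(** * The structure constants *)

Section StructureConstants.
Context {K : fieldType} (q : K).
Hypothesis q_neq0 : q != 0.

Lemma qlambdaDl (m n : Z2) :
  qlambda q (m + n) n = q ^ (n.1 * n.2) * qlambda q m n.
Proof.
rewrite /qlambda /= !mulrDl !expfzDr // (mulrC n.2).
by rewrite mulrBr !(mulrC (q ^ (n.1 * n.2))).
Qed.

Lemma qlambdaDlN (m n : Z2) :
  qlambda q (m + n) (- n) = q ^ (- (n.1 * n.2)) * qlambda q m (- n).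
Proof.
rewrite /qlambda /= !mulrDl !expfzDr // !mulrN (mulrC n.2).
by rewrite mulrBr !(mulrC (q ^ (- (n.1 * n.2)))).
Qed.

Lemma qlambda_doubler (m n : Z2) :
  qlambda q m (n + n) =
  qlambda q m n * (q ^ (m.2 * n.1) + q ^ (m.1 * n.2)).
Proof. by rewrite /qlambda /= !mulrDr !expfzDr //; ring. Qed.

Lemma qlambdaNm (m : Z2) : qlambda q (- m) m = 0.
Proof. by rewrite /qlambda /= !mulNr (mulrC m.2) subrr. Qed.

Hypothesis q_not_root_of_unity : forall t : nat, (0 < t)%N -> q ^+ t <> 1.

Lemma exprz_inj (a b : int) : q ^ a = q ^ b -> a = b.
Proof.
have expz1 (c : int) : q ^ c = 1 -> c = 0.
  case: c => [[//|n]|n] E; first by case: (q_not_root_of_unity (ltn0Sn n)).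
  case: (q_not_root_of_unity (ltn0Sn n)).
  by apply: invr_inj; rewrite invr1.
move=> E; apply/eqP; rewrite -subr_eq0; apply/eqP/expz1.
by rewrite expfzDr // E -expfzDr // subrr expr0z.
Qed.

Lemma qlambda_neq0 (m n : Z2) : indep m n -> qlambda q m n != 0.
Proof.
by apply: contraNneq => /eqP; rewrite subr_eq0 => /eqP/exprz_inj ->.
Qed.

End StructureConstants.

(** * The functional equation *)

Section FunctionalEquation.
Context {K : numFieldType} (q : K).
Hypothesis q_neq0 : q != 0.
Hypothesis q_not_root_of_unity : forall t : nat, (0 < t)%N -> q ^+ t <> 1.

(** The degree [d] part of the half-derivation identity, in coordinates. The
    values at [0] and [- d] correspond to [D(0) = 0] and to the missing basis
    vector of index [0]; setting both to zero makes the equation hold for all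
    [m] and [n], including those with [m + n + d = 0]. *)
Definition half_cocycle (d : Z2) (f : Z2 -> K) : Prop :=
  [/\ f 0 = 0, f (- d) = 0 &
   forall m n, 2 * (qlambda q m n * f (m + n)) =
     qlambda q (m + d) n * f m + qlambda q m (n + d) * f n].

(** The pair [(m + d, - d)]: the term in [f (- d)] drops out. *)
Lemma half_cocycle_shift (d : Z2) (f : Z2 -> K) : half_cocycle d f ->
  forall m, indep m d -> f (m + d) = 2 * q ^ (d.1 * d.2) * f m.
Proof.
move=> [_ fNd fE] m m_d; have l0 : qlambda q (m + d) (- d) != 0.
  by apply: qlambda_neq0; rewrite // indepNr indepDl.
have := fE (m + d) (- d); rewrite addrK fNd mulr0 addr0.
rewrite (qlambdaDlN q_neq0 (m + d)).
rewrite mulrCA (mulrC (q ^ _)) -[RHS]mulrA => /(mulfI l0) E.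
rewrite -mulrA mulrCA E.
by rewrite -invr_expz; field; rewrite expfz_neq0.
Qed.

(** The pair [(m, d)], with [f (m + d)] eliminated by [half_cocycle_shift]; the
    factor [3] is [4 - 1]. *)
Lemma half_cocycle_value (d : Z2) (f : Z2 -> K) : half_cocycle d f ->
  forall m, indep m d -> 3 * q ^ (d.1 * d.2) * f m =
    (q ^ (m.2 * d.1) + q ^ (m.1 * d.2)) * f d.
Proof.
move=> fc m m_d; have [_ _ fE] := fc.
have := fE m d; rewrite (qlambdaDl q_neq0) (qlambda_doubler q_neq0).
rewrite (half_cocycle_shift fc m_d) => E.
apply: (mulfI (qlambda_neq0 q_neq0 q_not_root_of_unity m_d)).
transitivity (2 * (qlambda q m d * (2 * q ^ (d.1 * d.2) * f m)) -
  q ^ (d.1 * d.2) * qlambda q m d * f m); first by ring.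
by rewrite E; ring.
Qed.

(** The closed form of [half_cocycle_value] grows by the factor [Q] from [m] to
    [m + d], whereas [half_cocycle_shift] imposes [2 Q]. *)
Lemma half_cocycle_indep (d : Z2) (f : Z2 -> K) : half_cocycle d f ->
  forall m, indep m d -> f m = 0.
Proof.
move=> fc m m_d; have md_d : indep (m + d) d by rewrite indepDl.
have Q0 : q ^ (d.1 * d.2) != 0 by rewrite expfz_neq0.
have := half_cocycle_value fc md_d.
have -> : q ^ ((m + d).2 * d.1) + q ^ ((m + d).1 * d.2) =
    (q ^ (m.2 * d.1) + q ^ (m.1 * d.2)) * q ^ (d.1 * d.2).
  rewrite /= [in LHS]mulrDl [(m.1 + _) * _]mulrDl !expfzDr //.
  by rewrite (mulrC d.2) mulrDl.
rewrite [RHS]mulrAC.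
rewrite -(half_cocycle_value fc m_d) (half_cocycle_shift fc m_d) => E.
have /eqP : 3 * q ^ (d.1 * d.2) * q ^ (d.1 * d.2) * f m = 0.
  set Q := q ^ _ in E *; transitivity
    (3 * Q * (2 * Q * f m) - 3 * Q * f m * Q); first by ring.
  by rewrite E subrr.
by rewrite !mulf_eq0 (negPf Q0) pnatr_eq0 => /eqP.
Qed.

Lemma half_cocycle_eq0 (d : Z2) (f : Z2 -> K) : half_cocycle d f ->
  d != 0 -> forall m, f m = 0.
Proof.
move=> fc d0 k; have [f0 _ fE] := fc.
have [k_d|k_d] := boolP (indep k d); first exact: half_cocycle_indep fc _ k_d.
have [->//|k0] := eqVneq k 0.
(* [k] is on the line of [d], but [m] and [k - m] are not. *)
have [m [m_k m_d]] := exists_indep2 k0 d0.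
have := fE m (k - m); rewrite subrKC.
rewrite (half_cocycle_indep fc m_d).
rewrite (half_cocycle_indep fc (indepBl_dep m_d k_d)) !mulr0 addr0.
move/eqP; rewrite !mulf_eq0 pnatr_eq0 /= (negPf (qlambda_neq0 _ _ _)) //.
  by move/eqP.
by rewrite indepBr.
Qed.

(** In degree [0], [2 f(m+n) = f(m) + f(n)] for independent [m] and [n]; this is
    applied to [(m, n)] and to [(m + n, - n)]. As the left side does not involve [m], [f] takes a single
    value off the line of [n]. *)
Lemma half_cocycle_opp (f : Z2 -> K) : half_cocycle 0 f ->
  forall m n, indep m n -> 2 * f (- n) = 3 * f m - f n.
Proof.
move=> [_ _ fE] m n m_n.
have mean p r : indep p r -> 2 * f (p + r) = f p + f r.
  move=> p_r; apply: (mulfI (qlambda_neq0 q_neq0 q_not_root_of_unity p_r)).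
  by rewrite mulrCA fE !addr0 mulrDr.
have E1 := mean _ _ m_n; have := mean (m + n) (- n).
rewrite indepNr indepDl addrK => /(_ m_n) E2.
have -> : f n = 2 * f (m + n) - f m by rewrite E1; ring.
have -> : f (- n) = 2 * f m - f (m + n) by rewrite E2; ring.
by ring.
Qed.

Lemma half_cocycle_const (f : Z2 -> K) : half_cocycle 0 f ->
  forall m n, m != 0 -> n != 0 -> f m = f n.
Proof.
move=> fc m n m0 n0; have [k [k_m k_n]] := exists_indep2 m0 n0.
have indepC p r : indep p r = indep r p.
  by rewrite /indep (mulrC p.2) (mulrC p.1) eq_sym.
have := half_cocycle_opp fc; move: k_m k_n.
rewrite !(indepC k) => k_m k_n E; have := E _ _ k_n.
by rewrite (E _ _ k_m) => /addIr/mulfI; apply; rewrite pnatr_eq0.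
Qed.

End FunctionalEquation.

(** * Coordinates *)

Section Coordinates.
Context {K : fieldType}.

(** Zero at [k = 0], in accordance with the convention [x^0 = 0]. *)
Definition xcoef (k : Z2) (u : qtorus K) : K :=
  if insub k is Some k' then mcoeff (inl (k' : Z2star)) u else 0.

Definition Dcoef (k : Z2) (u : qtorus K) : K :=
  if insub k is Some k' then mcoeff (inr (k' : Z2star)) u else 0.

Fact xcoef_linear k : linear (xcoef k : qtorus K -> K^o).
Proof.
move=> a u v; rewrite /xcoef; case: insubP => [k' _ _|_].
  by rewrite mcoeffD mcoeffZ.
by rewrite scaler0 addr0.
Qed.

Fact Dcoef_linear k : linear (Dcoef k : qtorus K -> K^o).
Proof.
move=> a u v; rewrite /Dcoef; case: insubP => [k' _ _|_].
  by rewrite mcoeffD mcoeffZ.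
by rewrite scaler0 addr0.
Qed.

HB.instance Definition _ k :=
  GRing.isLinear.Build K (qtorus K) K^o *:%R (xcoef k) (xcoef_linear k).
HB.instance Definition _ k :=
  GRing.isLinear.Build K (qtorus K) K^o *:%R (Dcoef k) (Dcoef_linear k).

Lemma xcoefZ k a u : xcoef k (a *: u) = a * xcoef k u.
Proof. exact: linearZ. Qed.

Lemma DcoefZ k a u : Dcoef k (a *: u) = a * Dcoef k u.
Proof. exact: linearZ. Qed.

Definition coefZ := (xcoefZ, DcoefZ).

Lemma xcoef0 u : xcoef 0 u = 0.
Proof. by rewrite /xcoef insubF ?eqxx. Qed.

Lemma Dcoef0 u : Dcoef 0 u = 0.
Proof. by rewrite /Dcoef insubF ?eqxx. Qed.

Lemma coef_ext (u v : qtorus K) :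
  (forall k, k != 0 -> xcoef k u = xcoef k v) ->
  (forall k, k != 0 -> Dcoef k u = Dcoef k v) -> u = v.
Proof.
move=> ux uD; apply/malgP => -[k|k].
  by have := ux _ (valP k); rewrite /xcoef valK.
by have := uD _ (valP k); rewrite /Dcoef valK.
Qed.

Lemma xcoef_xgen k m : xcoef k (xgen m) = ((m == k) && (k != 0))%:R.
Proof.
have [->|[{}k ->]] := Z2P k; first by rewrite xcoef0 eqxx andbF.
rewrite (valP k) andbT /xcoef valK.
have [->|[{}m ->]] := Z2P m.
  by rewrite xgen0 mcoeff0 eq_sym (negPf (valP k)).
by rewrite xgenE mcoeffU.
Qed.

Lemma Dcoef_Dgen k m : Dcoef k (Dgen m) = ((m == k) && (k != 0))%:R.
Proof.
have [->|[{}k ->]] := Z2P k; first by rewrite Dcoef0 eqxx andbF.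
rewrite (valP k) andbT /Dcoef valK.
have [->|[{}m ->]] := Z2P m.
  by rewrite Dgen0 mcoeff0 eq_sym (negPf (valP k)).
by rewrite DgenE mcoeffU.
Qed.

Lemma xcoef_Dgen k m : xcoef k (Dgen m) = 0.
Proof.
rewrite /xcoef; case: insubP => // k' _ _; have [->|[{}m ->]] := Z2P m.
  by rewrite Dgen0 mcoeff0.
by rewrite DgenE mcoeffU.
Qed.

Lemma Dcoef_xgen k m : Dcoef k (xgen m) = 0.
Proof.
rewrite /Dcoef; case: insubP => // k' _ _; have [->|[{}m ->]] := Z2P m.
  by rewrite xgen0 mcoeff0.
by rewrite xgenE mcoeffU.
Qed.

Lemma qtorus_scalar_ext (F G : qtorus K -> K^o) : linear F -> linear G ->
  (forall m, F (xgen m) = G (xgen m)) -> (forall m, F (Dgen m) = G (Dgen m)) ->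
  F =1 G.
Proof.
move=> linF linG Fx FD u; apply/eqP; rewrite -subr_eq0; apply/eqP.
move: u; apply: (@malg_linear_eq0 _ _ _ (fun u => F u - G u)) => [a u v|[m|m]].
- by rewrite linF linG opprD addrACA scalerBr.
- by rewrite -xgenE Fx subrr.
- by rewrite -DgenE FD subrr.
Qed.

(** Matches the coefficient of a translated basis vector with the translated
    coefficient. The factors [qlambda] vanish where the convention on the
    index [0] would break the equality: at [m = 0] and at [m + n = 0]. *)
Lemma qlambda_delta (q : K) (m n k : Z2) :
  qlambda q m n * ((m + n == k) && (k != 0))%:R =
  qlambda q (k - n) n * ((m == k - n) && (k - n != 0))%:R.
Proof.
rewrite -(inj_eq (addIr n) m (k - n)) subrK.
have [<-|_] := eqVneq (m + n) k; last by rewrite !mulr0.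
rewrite addrK /=; have [->|_] := eqVneq m 0.
  by rewrite qlambda0l !mul0r.
have [/eqP|//] := eqVneq (m + n) 0.
by rewrite addr_eq0 => /eqP ->; rewrite qlambdaNm !mul0r.
Qed.

Section BracketCoordinates.
Context (q : K).

Lemma linear_coef_bracket (c : {linear qtorus K -> K^o}) v :
  linear (fun u => c (qbracket q u v)).
Proof. by move=> a u w; rewrite qbracketDl qbracketZl linearP. Qed.

Lemma linear_coef_scale (c : {linear qtorus K -> K^o}) (b : K) :
  linear (fun u => b * c u : K^o).
Proof. by move=> a u w; rewrite linearP /= mulrDr scalerAr. Qed.

Lemma xcoef_bracketD u n k :
  xcoef k (qbracket q u (Dgen n)) = qlambda q (k - n) n * xcoef (k - n) u.
Proof.
move: u; apply: (qtorus_scalar_ext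
  (linear_coef_bracket _ _) (linear_coef_scale _ _)) => m /=.
  by rewrite qbracket_xD !coefZ !xcoef_xgen qlambda_delta.
by rewrite qbracket_DD !coefZ !xcoef_Dgen !mulr0.
Qed.

Lemma Dcoef_bracketD u n k :
  Dcoef k (qbracket q u (Dgen n)) = qlambda q (k - n) n * Dcoef (k - n) u.
Proof.
move: u; apply: (qtorus_scalar_ext
  (linear_coef_bracket _ _) (linear_coef_scale _ _)) => m /=.
  by rewrite qbracket_xD !coefZ !Dcoef_xgen !mulr0.
by rewrite qbracket_DD !coefZ !Dcoef_Dgen qlambda_delta.
Qed.

Lemma Dcoef_bracketx u n k : Dcoef k (qbracket q u (xgen n)) = 0.
Proof.
move: u; apply: (@qtorus_scalar_ext _ (fun=> 0)
  (linear_coef_bracket _ _)) => [a u w|m|m] /=.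
- by rewrite scaler0 addr0.
- by rewrite qbracket_xx !coefZ Dcoef_xgen mulr0.
- by rewrite qbracket_Dx !coefZ Dcoef_xgen mulr0.
Qed.

Lemma xcoef_bracketx u n k :
  xcoef k (qbracket q u (xgen n)) =
  qlambda q (k - n) n * (xcoef (k - n) u + Dcoef (k - n) u).
Proof.
move: u; apply: (@qtorus_scalar_ext _
  (fun u => qlambda q (k - n) n * (xcoef (k - n) u + Dcoef (k - n) u))
  (linear_coef_bracket _ _)) => [a u w|m|m] /=.
- by rewrite !linearD /= xcoefZ DcoefZ addrACA -mulrDr [LHS]mulrDr mulrCA.
- rewrite qbracket_xx !coefZ !xcoef_xgen Dcoef_xgen addr0.
  by rewrite qlambda_delta.
- rewrite qbracket_Dx !coefZ xcoef_xgen xcoef_Dgen Dcoef_Dgen add0r.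
  by rewrite qlambda_delta.
Qed.

End BracketCoordinates.

End Coordinates.

(** * Half-derivations of the quantum torus *)

Section HalfDerivations.
Context {K : numFieldType} (q : K).
Hypothesis q_neq0 : q != 0.
Hypothesis q_not_root_of_unity : forall t : nat, (0 < t)%N -> q ^+ t <> 1.
Variable phi : {linear qtorus K -> qtorus K}.
Hypothesis phi_half : half_derivation (qbracket q) phi.

(** With [[u, phi v] = - [phi v, u]], only brackets with a basis vector on the
    right need coordinates. *)
Lemma half_derivation_coef (c : {linear qtorus K -> K^o}) u v :
  2 * c (phi (qbracket q u v)) =
  c (qbracket q (phi u) v) - c (qbracket q (phi v) u).
Proof.
rewrite phi_half linearZ linearD /= (qbracketC q u) linearN /=.
by apply: mulVKf; rewrite pnatr_eq0.
Qed.

Lemma degreeE (m n d : Z2) :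
  (m + n + d - n = m + d) * (m + n + d - m = n + d).
Proof.
by split; [rewrite addrAC addrK | rewrite -(addrA m) addrAC subrr add0r].
Qed.

Lemma half_cocycle_DD (d : Z2) :
  half_cocycle q d (fun m => Dcoef (m + d) (phi (Dgen m))).
Proof.
split=> [||m n]; first by rewrite Dgen0 linear0 linear0.
  by rewrite addNr Dcoef0.
have := half_derivation_coef (Dcoef (m + n + d)) (Dgen m) (Dgen n).
rewrite qbracket_DD linearZ /= !coefZ !Dcoef_bracketD !degreeE => ->.
by rewrite (qlambdaC q (n + d) m) mulNr.
Qed.

Lemma half_cocycle_Dx (d : Z2) :
  half_cocycle q d (fun m => xcoef (m + d) (phi (Dgen m))).
Proof.
split=> [||m n]; first by rewrite Dgen0 linear0 linear0.
  by rewrite addNr xcoef0.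
have := half_derivation_coef (xcoef (m + n + d)) (Dgen m) (Dgen n).
rewrite qbracket_DD linearZ /= !coefZ !xcoef_bracketD !degreeE => ->.
by rewrite (qlambdaC q (n + d) m) mulNr.
Qed.

(** [x^m] is a multiple of [[x^p, x^(m-p)]], and bracketing with an [x] has no
    [D]-component. *)
Lemma Dcoef_phi_x (m k : Z2) : Dcoef k (phi (xgen m)) = 0.
Proof.
have [->|m0] := eqVneq m 0; first by rewrite xgen0 !linear0.
have [p [p_m _]] := exists_indep2 m0 m0.
have := half_derivation_coef (Dcoef k) (xgen p) (xgen (m - p)).
rewrite qbracket_xx linearZ /= !coefZ !Dcoef_bracketx subrr subrKC.
move/eqP; rewrite !mulf_eq0 pnatr_eq0 /= (negPf (qlambda_neq0 _ _ _)) //.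
  by move/eqP.
by rewrite indepBr.
Qed.

Lemma half_cocycle_xx (d : Z2) :
  half_cocycle q d (fun m => xcoef (m + d) (phi (xgen m))).
Proof.
split=> [||m n]; first by rewrite xgen0 linear0 linear0.
  by rewrite addNr xcoef0.
have := half_derivation_coef (xcoef (m + n + d)) (xgen m) (xgen n).
rewrite qbracket_xx linearZ /= !coefZ !xcoef_bracketx !Dcoef_phi_x !addr0.
rewrite !degreeE => ->.
by rewrite (qlambdaC q (n + d) m) mulNr.
Qed.

Lemma xcoef_phi_sum (m n : Z2) : indep m n ->
  2 * xcoef (m + n) (phi (xgen (m + n))) =
  xcoef m (phi (Dgen m)) + Dcoef m (phi (Dgen m)) + xcoef n (phi (xgen n)).
Proof.
move=> m_n; apply: (mulfI (qlambda_neq0 q_neq0 q_not_root_of_unity m_n)).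
have := half_derivation_coef (xcoef (m + n)) (Dgen m) (xgen n).
rewrite qbracket_Dx linearZ /= !coefZ xcoef_bracketx xcoef_bracketD addrK.
rewrite (addrAC m) subrr add0r => E.
by rewrite mulrCA E (qlambdaC q m n) mulNr opprK -mulrDr.
Qed.

Lemma half_derivation_scalars : exists c d : K, forall m : Z2, m != 0 ->
  phi (xgen m) = (c + d) *: xgen m /\
  phi (Dgen m) = c *: xgen m + d *: Dgen m.
Proof.
pose e : Z2 := (1, 0).
(* [g m k] stands for the coefficient of index [k] of the image of the basis
   vector of index [m]. *)
have diag (g : Z2 -> Z2 -> K) :
    (forall d, half_cocycle q d (fun m => g m (m + d))) ->
    forall m k, m != 0 -> g m k = if m == k then g e e else 0.
  move=> gc m k m0; have -> : k = m + (k - m) by rewrite subrKC.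
  have [->|km] := eqVneq k m.
    rewrite subrr addr0 eqxx.
    have := half_cocycle_const q_neq0 q_not_root_of_unity (gc 0) m0 (n := e).
    by rewrite !addr0; apply.
  rewrite (half_cocycle_eq0 q_neq0 q_not_root_of_unity (gc _)) ?subr_eq0 //.
  by rewrite subrKC eq_sym (negPf km).
have dDD := diag (fun m k => Dcoef k (phi (Dgen m))) half_cocycle_DD.
have dDx := diag (fun m k => xcoef k (phi (Dgen m))) half_cocycle_Dx.
have dxx := diag (fun m k => xcoef k (phi (xgen m))) half_cocycle_xx.
set c := xcoef e (phi (Dgen e)) in dDx.
set d := Dcoef e (phi (Dgen e)) in dDD.
set a := xcoef e (phi (xgen e)) in dxx.
have aE : a = c + d.
  have := @xcoef_phi_sum e (0, 1) isT.
  by rewrite !(dxx, dDx, dDD) // !eqxx mulr_natl mulr2n => /addIr.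
exists c, d => m m0; split.
  apply: coef_ext => k k0; rewrite !coefZ.
    rewrite dxx // xcoef_xgen k0 andbT aE.
    by case: eqP => _; rewrite ?mulr1 ?mulr0.
  by rewrite Dcoef_phi_x Dcoef_xgen mulr0.
apply: coef_ext => k k0; rewrite linearD /= !coefZ.
  rewrite dDx // xcoef_xgen xcoef_Dgen mulr0 addr0 k0 andbT.
  by case: eqP => _; rewrite ?mulr1 ?mulr0.
rewrite dDD // Dcoef_xgen Dcoef_Dgen mulr0 add0r k0 andbT.
by case: eqP => _; rewrite ?mulr1 ?mulr0.
Qed.

End HalfDerivations.

Theorem theorem4p1 (R : realType) (q : R[i]) (q_neq0 : q != 0)
    (q_not_root_of_unity : forall t : nat, (0 < t)%N -> q ^+ t <> 1)
    (phi : {linear qtorus R[i] -> qtorus R[i]})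
    (phi_half : half_derivation (qbracket q) phi) :
  exists c d : R[i], forall m : Z2, m != 0 ->
    phi (xgen m) = (c + d) *: xgen m /\
    phi (Dgen m) = c *: xgen m + d *: Dgen m.
Proof.
exact:
  (@half_derivation_scalars R[i] q q_neq0 q_not_root_of_unity phi phi_half).
Qed.
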